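(* The class of all (finite) strongly supersoluble groups is a local formation and has a local screen $f$ such that $f(p)=\mathfrak{A}(p-1)\cap\mathfrak{B}$ for every prime $p$. (That is, $s\mathfrak{U}=LF(f)$ for this $f$, where $s\mathfrak{U}$ is the class of all strongly supersoluble groups.)
   Context: All groups are finite. A subgroup $M$ of a group $G$ is called modular in $G$ if: (1) $\langle X, M\cap Z\rangle=\langle X,M\rangle\cap Z$ for all $X\le G$, $Z\le G$ with $X\le Z$; and (2) $\langle M, Y\cap Z\rangle=\langle M,Y\rangle\cap Z$ for all $Y\le G$, $Z\le G$ with $M\le Z$. A subgroup $H$ of $G$ is called submodular in $G$ if there is a chain of subgroups $H=H_0\le H_1\le\dots\le H_s=G$ such that $H_{i-1}$ is modular in $H_i$ for $i=1,\dots,s$. A group is called strongly supersoluble if it is supersoluble and every Sylow subgroup of it is submodular in it. $\mathfrak{A}(p-1)$ is the class of all abelian groups of exponent dividing $p-1$; $\mathfrak{B}$ is the class of all abelian groups whose exponent is squarefree (not divisible by the square of any prime). A class of groups (closed under isomorphism) $\mathfrak{F}$ is a formation if (a) every quotient of a group in $\mathfrak{F}$ lies in $\mathfrak{F}$, and (b) whenever $A,B$ are normal subgroups of a group $H$ with $H/A\in\mathfrak{F}$ and $H/B\in\mathfrak{F}$, then $H/(A\cap B)\in\mathfrak{F}$. A local screen is a function $f$ from the set of all primes to formations. $LF(f)$ denotes the class of all groups $G$ such that $G/C_G(H/K)\in f(p)$ for every chief factor $H/K$ of $G$ and every prime $p$ dividing $|H/K|$. A formation $\mathfrak{F}$ is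 local if $\mathfrak{F}=LF(f)$ for some local screen $f$; then $f$ is a local screen of $\mathfrak{F}$. *)

(* Defs.v *)
From mathcomp Require Import all_boot all_fingroup all_solvable.

Set Implicit Arguments.
Unset Strict Implicit.
Unset Printing Implicit Defensive.

Local Open Scope group_scope.

Section Submodular.

Variable gT : finGroupType.
Implicit Types (M G V U : {set gT}) (H : {group gT}).

(* Defined on sets, so that modular.-series makes sense; only used when both
   arguments are groups. *)
Definition modular M G : bool :=
  [&& M \subset G,
      [forall X : {group gT}, forall Z : {group gT},
         [&& X \subset G, Z \subset G & X \subset Z] ==>
           (X <*> (M :&: Z) == (X <*> M) :&: Z)] &
      [forall Y : {group gT}, forall Z : {group gT},
         [&& Y \subset G, Z \subset G & M \subset Z] ==>
           (M <*> (Y :&: Z) == (M <*> Y) :&: Z)]].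

Definition submodular H (G : {group gT}) : Prop :=
  exists2 s : seq {group gT}, modular.-series H s & last H s = G.

Definition normal_cyclic_factor G V U : bool :=
  [&& V <| G, U <| G, V \subset U & cyclic (U / V)].

Definition supersoluble (G : {group gT}) : Prop :=
  exists2 s : seq {group gT},
    (normal_cyclic_factor G).-series 1%G s & last 1%G s = G.

End Submodular.

Definition group_class := forall gT : finGroupType, {group gT} -> Prop.

Definition eq_class (F1 F2 : group_class) : Prop :=
  forall (gT : finGroupType) (G : {group gT}), F1 gT G <-> F2 gT G.

Definition classI (F1 F2 : group_class) : group_class :=
  fun gT G => F1 gT G /\ F2 gT G.

Definition isog_closed (F : group_class) : Prop :=
  forall (gT rT : finGroupType) (G : {group gT}) (H : {group rT}),
    G \isog H -> F gT G -> F rT H.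

Definition quotient_closed (F : group_class) : Prop :=
  forall (gT : finGroupType) (G N : {group gT}),
    N <| G -> F gT G -> F _ (G / N)%G.

Definition residual_closed (F : group_class) : Prop :=
  forall (gT : finGroupType) (H A B : {group gT}),
    A <| H -> B <| H -> F _ (H / A)%G -> F _ (H / B)%G ->
    F _ (H / (A :&: B))%G.

Definition formation (F : group_class) : Prop :=
  [/\ isog_closed F, quotient_closed F & residual_closed F].

(* A local screen is only relevant at the primes; its values at the other
   natural numbers are junk. *)
Definition local_screen (f : nat -> group_class) : Prop :=
  forall p : nat, prime p -> formation (f p).

(* chief_factor G K H means that H / K is a chief factor of G, and
   'C_G(H / K | 'Q) is the centraliser of H / K in G, for the action of G by
   conjugation. *)
Definition LF (f : nat -> group_class) : group_class :=
  fun gT G =>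
    forall H K : {group gT}, chief_factor G K H ->
    forall p : nat, prime p -> p %| #|H / K| ->
    f p _ (G / 'C_G(H / K | 'Q))%G.

Definition local_screen_of (F : group_class) (f : nat -> group_class) : Prop :=
  local_screen f /\ eq_class F (LF f).

Definition local_formation (F : group_class) : Prop :=
  formation F /\ exists f : nat -> group_class, local_screen_of F f.

Definition strongly_supersoluble : group_class :=
  fun gT G =>
    supersoluble G /\
    forall (p : nat) (P : {group gT}),
      prime p -> P \in 'Syl_p(G) -> submodular P G.

Definition abelian_exponent_dvd (n : nat) : group_class :=
  fun gT G => abelian G /\ exponent G %| n.

Definition abelian_squarefree_exponent : group_class :=
  fun gT G =>
    abelian G /\ forall q : nat, prime q -> ~~ (q ^ 2 %| exponent G)%N.

(* Main.v *)
Require Import Defs.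
From mathcomp Require Import all_boot all_fingroup all_solvable.
From mathcomp Require Import all_algebra all_field all_character.

(* Let f p be the class of abelian groups of squarefree exponent dividing p - 1.
   If G is strongly supersoluble and H / K is a chief factor, of prime order r,
   then G / C_G(H / K) is cyclic of order dividing r - 1.  In a submodular chain
   from a Sylow q-subgroup to G there is a first step M <= L, M modular in L, at
   which H / K becomes covered.  Then M / C_M(H / K) has no proper nontrivial
   subgroup: the preimage E of one would violate the modularity of M on the pair
   E ^ v <= M ^ v, for v in L :&: H outside K.  So the q-part of the order of
   G / C_G(H / K) is at most q.
   Conversely, if G is in LF f then G / C_G(H / K) is abelian of exponent
   dividing p - 1, hence acts on the elementary abelian p-group H / K by
   simultaneously diagonalisable maps, and H / K has order p.  Multiplying a
   Sylow subgroup P by the terms N_i of a chief series gives a submodular chain: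
   modulo the part of P N_i that centralises N_(i+1) / N_i, the group P N_(i+1)
   has order dividing a product of two primes, and all subgroups of such a group
   are modular. *)

Set Implicit Arguments.
Unset Strict Implicit.
Unset Printing Implicit Defensive.

Local Open Scope group_scope.

(** * Chief factors, and LF f as a formation *)

Section ChiefFactors.

Variable gT : finGroupType.
Implicit Types G H K N X : {group gT}.

Lemma chief_factorP G K H :
  reflect [/\ K <| G, H <| G, K \proper H &
              forall N, N <| G -> K \subset N -> N \subset H ->
                N = K \/ N = H]
          (chief_factor G K H).
Proof.
apply: (iffP andP) => [[/maxgroupP[/andP[pKH nKG] maxK] nsHG] | [nsKG nsHG pKH chiefK]].
  have sKG := subset_trans (proper_sub pKH) (normal_sub nsHG).
  split=> // [|N /andP[_ nNG] sKN]; first exact/andP.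
  rewrite subEproper => /predU1P[/group_inj | pNH]; first by right.
  by left; apply: group_inj; apply: maxK; rewrite ?pNH.
split=> //; apply/maxgroupP; rewrite pKH normal_norm //; split=> // N.
case/andP=> pNH nNG sKN.
have nsNG: N <| G.
  by rewrite /normal nNG (subset_trans (proper_sub pNH)) ?normal_sub.
by have [-> | eNH] := chiefK N nsNG sKN (proper_sub pNH); last rewrite eNH properxx in pNH.
Qed.

(** Turns centralising a factor into a commutator inclusion, the form in which centralisers of
    different factors can be compared. *)
Lemma sub_cent_factor G K H (X : {set gT}) :
    K <| G -> H <| G -> X \subset G ->
  (X \subset 'C_G(H / K | 'Q)) = ([~: X, H] \subset K).
Proof.
case/andP=> _ nKG /andP[sHG _] sXG; rewrite subsetI sXG /=.
by rewrite sub_astabQR // (subset_trans _ nKG).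
Qed.

Lemma cent_factor_normal G K H :
  K <| G -> H <| G -> 'C_G(H / K | 'Q) <| G.
Proof.
move=> nsKG nsHG; rewrite /normal subsetIl /= astabQ.
rewrite normsI ?normG // -(quotientGK nsKG).
by rewrite morphpre_norms // norms_cent // quotient_norms ?normal_norm.
Qed.

(* For H and K1 normal in G, the factors H / (H :&: K1) and H K1 / K1 are
   G-isomorphic. *)
Lemma chief_factor_join G H K1 :
    H <| G -> K1 <| G ->
  chief_factor G (H :&: K1) H = chief_factor G K1 (H <*> K1).
Proof.
move=> nsHG nsK1G.
have nHK1 : H \subset 'N(K1) := subset_trans (normal_sub nsHG) (normal_norm nsK1G).
apply/chief_factorP/chief_factorP=> [] [_ _ pr chiefH].
  split; rewrite ?normalY ?properE ?joing_subr //=.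
    apply: contraL pr; rewrite join_subG => /andP[sHK1 _].
    by rewrite /= (setIidPl sHK1) properxx.
  move=> N nsNG sK1N sNHK1.
  (* Dedekind's law: [N] lies between [K1] and [H <*> K1], so it is recovered from [H :&: N]. The
     converse direction recovers [N] from [N <*> K1] in the same way. *)
  have defN : N = ((H :&: N) <*> K1)%G.
    apply: group_inj; rewrite /= norm_joinEl ?subIset ?nHK1 //=.
    rewrite setIC group_modr // -norm_joinEl //.
    by apply/esym/setIidPl.
  have [|||defHN|defHN] := chiefH (H :&: N)%G.
  - exact: normalI.
  - exact: setIS.
  - exact: subsetIl.
  - left; rewrite defN; apply: group_inj.
    by rewrite [(H :&: N)%G]defHN /=; apply/joing_idPr; rewrite subsetIr.
  by right; rewrite defN defHN.
split; rewrite ?normalI ?properE ?subsetIl //=.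
  rewrite subsetI subxx /=; apply: contraL pr => sHK1.
  by rewrite /= (joing_idPr sHK1) properxx.
move=> N nsNG sKN sNH.
have defN : N = (H :&: (N <*> K1))%G.
  apply: group_inj; rewrite /= norm_joinEl ?(subset_trans sNH) //.
  by rewrite setIC -group_modl //= (setIC (gval K1)) mulGSid.
have [|||defNK|defNK] := chiefH (N <*> K1)%G.
- exact: normalY.
- exact: joing_subr.
- by rewrite genS ?setSU.
- by left; rewrite defN defNK.
by right; rewrite defN defNK; apply: group_inj; apply/setIidPl; apply: joing_subl.
Qed.

(** For [X] in [G], the commutator of [X] with the normal subgroup [H] lies in [H] anyway, so it
    lies in [H :&: K1] exactly when it lies in [K1]. *)
Lemma cent_factor_join G H K1 :
    H <| G -> K1 <| G ->
  'C_G(H / (H :&: K1) | 'Q) = 'C_G((H <*> K1) / K1 | 'Q).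
Proof.
move=> nsHG nsK1G.
have nHK1 : H \subset 'N(K1) := subset_trans (normal_sub nsHG) (normal_norm nsK1G).
rewrite quotientYidr //.
have sub_astab (X : {set gT}) : X \subset G ->
  (X \subset 'C(H / (H :&: K1) | 'Q)) = (X \subset 'C(H / K1 | 'Q)).
  move=> sXG; have [nHX nK1X] : X \subset 'N(H) /\ X \subset 'N(K1).
    by split; apply: subset_trans sXG _; apply: normal_norm.
  rewrite !sub_astabQR ?normsI ?normG //.
  rewrite subsetI (subset_trans (commSg H sXG)) //.
  by rewrite commg_subr normal_norm.
apply/eqP; rewrite eqEsubset; apply/andP; split; apply/subsetIP; split.
- exact: subsetIl.
- by rewrite -sub_astab ?subsetIl // subsetIr.
- exact: subsetIl.
by rewrite sub_astab ?subsetIl // subsetIr.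
Qed.

Lemma card_factor_join G H K1 :
  H <| G -> K1 <| G -> #|H / (H :&: K1)| = #|(H <*> K1) / K1|.
Proof.
move=> nsHG nsK1G.
have nHK1 : H \subset 'N(K1) := subset_trans (normal_sub nsHG) (normal_norm nsK1G).
by rewrite quotientYidr // setIC; apply/card_isog/second_isog.
Qed.

End ChiefFactors.

(** * Chief factors and centralisers under a morphism *)

Section MorphicFactors.

Variables (gT rT : finGroupType) (D G : {group gT}) (f : {morphism D >-> rT}).
Hypotheses (sGD : G \subset D) (sKerG : 'ker f \subset G).
Implicit Types H K C : {group rT}.

Let morphpreKG : f @*^-1 (f @* G) = G.
Proof. by rewrite morphimGK. Qed.

Let morphpre_normalG H : H <| f @* G -> f @*^-1 H <| G.
Proof.
move=> nsHG; rewrite -[X in _ <| X]morphpreKG morphpre_normal ?morphimS //.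
by rewrite (subset_trans (normal_sub nsHG)) ?morphimS.
Qed.

Lemma chief_factor_morphpre K H :
    K <| f @* G -> H <| f @* G ->
  chief_factor G (f @*^-1 K) (f @*^-1 H) = chief_factor (f @* G) K H.
Proof.
move=> nsKG nsHG.
have sub_im L : L <| f @* G -> L \subset f @* D.
  by case/andP=> sLG _; apply: subset_trans sLG (morphimS f sGD).
have [sKim sHim] := (sub_im K nsKG, sub_im H nsHG).
apply/chief_factorP/chief_factorP=> [] [_ _ pr chiefH].
  split=> //; first by rewrite -(morphpre_proper sKim sHim).
  move=> N nsNG sKN sNH; have sNim := sub_im N nsNG.
  have [|||defN|defN] := chiefH (f @*^-1 N)%G.
  - exact: morphpre_normalG.
  - exact: morphpreS.
  - exact: morphpreS.
  - left; apply: group_inj; move/(congr1 (fun L : {group gT} => f @* L)): defN.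
    by rewrite /= !morphpreK.
  right; apply: group_inj; move/(congr1 (fun L : {group gT} => f @* L)): defN.
  by rewrite /= !morphpreK.
split; rewrite ?morphpre_normalG ?morphpre_proper //.
move=> N nsNG sKN sNH; have sND := subset_trans (normal_sub nsNG) sGD.
have sKerN : 'ker f \subset N by apply: subset_trans (ker_sub_pre f K) sKN.
have defN : N = (f @*^-1 (f @* N))%G by apply: group_inj; rewrite /= morphimGK.
have [|||eqN|eqN] := chiefH (f @* N)%G.
- exact: morphim_normal.
- by rewrite -(morphpreK sKim) morphimS.
- by rewrite -(morphpreK sHim) morphimS.
- by left; rewrite defN eqN.
by right; rewrite defN eqN.
Qed.

Lemma cent_factor_morphpre K H :
    K <| f @* G -> H <| f @* G ->
  'C_G(f @*^-1 H / f @*^-1 K | 'Q) = f @*^-1 'C_(f @* G)(H / K | 'Q).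
Proof.
move=> nsKG nsHG; have [nsKG' nsHG'] := (morphpre_normalG nsKG, morphpre_normalG nsHG).
have sHim : H \subset f @* D.
  exact: subset_trans (normal_sub nsHG) (morphimS f sGD).
have eqC (X : {set gT}) : X \subset G ->
  (X \subset 'C_G(f @*^-1 H / f @*^-1 K | 'Q))
    = (X \subset f @*^-1 'C_(f @* G)(H / K | 'Q)).
  move=> sXG; have sXD := subset_trans sXG sGD.
  rewrite -sub_morphim_pre // !sub_cent_factor ?morphimS //.
  rewrite -sub_morphim_pre ?morphimR ?morphpreK ?morphpre_sub //.
  by rewrite comm_subG ?morphpre_sub.
apply/eqP; rewrite eqEsubset; apply/andP; split.
  by rewrite -eqC ?subsetIl.
by rewrite eqC ?(normal_sub (morphpre_normalG (cent_factor_normal _ _))).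
Qed.

Lemma normal_over_ker (N : {group gT}) :
    N <| G -> 'ker f \subset N ->
  exists2 L : {group rT}, L <| f @* G & N = (f @*^-1 L)%G.
Proof.
move=> nsNG sKerN; exists (f @* N)%G; first exact: morphim_normal.
by apply: group_inj; rewrite /= morphimGK ?(subset_trans (normal_sub nsNG)).
Qed.

Lemma quotient_morphpre_isog C :
  C <| f @* G -> G / (f @*^-1 C) \isog f @* G / C.
Proof.
move=> nsCG; have nCG := normal_norm nsCG.
have sGf : G \subset f @*^-1 'N(C) by rewrite -sub_morphim_pre.
have := first_isog_loc (coset C \o f) sGf.
rewrite ker_comp ker_coset morphim_comp (setIidPr _) //.
by rewrite (subset_trans (morphpreS f (normal_sub nsCG))) ?morphpreKG.
Qed.

End MorphicFactors.


(* H / K is f-central in G; as in LF, only meaningful when K and H are normal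
   in G. *)
Definition f_central (f : nat -> group_class) (gT : finGroupType)
    (G K H : {group gT}) : Prop :=
  forall p, prime p -> p %| #|H / K| -> f p _ (G / 'C_G(H / K | 'Q))%G.

Lemma f_central_join f (gT : finGroupType) (G H K1 : {group gT}) :
    H <| G -> K1 <| G ->
  f_central f G (H :&: K1)%G H <-> f_central f G K1 (H <*> K1)%G.
Proof.
move=> nsHG nsK1G; rewrite /f_central (card_factor_join nsHG nsK1G).
have /group_inj eqC : 'C_G(H / (H :&: K1) | 'Q)%G :=: 'C_G((H <*> K1) / K1 | 'Q)%G.
  exact: cent_factor_join.
(* The type of [G / C1] depends on [C1], so equal centralisers are exchanged by substituting the
   group itself. *)
have quoC (C1 C2 : {group gT}) p :
  C1 = C2 -> f p _ (G / C1)%G -> f p _ (G / C2)%G by move->.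
by split=> fC p p_pr pHK; [apply: quoC eqC _ | apply: quoC (esym eqC) _]; apply: fC.
Qed.

(** Chief factors of the image correspond to those of [G] above the kernel, with equal orders and
    isomorphic quotients by the centralisers. Stated for a morphism so as to serve both isomorphisms
    and coset maps. *)
Lemma LF_morphim f (gT rT : finGroupType) (D G : {group gT})
    (phi : {morphism D >-> rT}) :
    (forall p, prime p -> isog_closed (f p)) -> G \subset D -> 'ker phi \subset G ->
  LF f (phi @* G)%G <->
  (forall H K : {group gT}, chief_factor G K H -> 'ker phi \subset K ->
   f_central f G K H).
Proof.
move=> isogf sGD sKerG.
have factor_isog (K H : {group rT}) : K <| phi @* G -> H <| phi @* G ->
  #|phi @*^-1 H / phi @*^-1 K| = #|H / K| /\
  G / 'C_G(phi @*^-1 H / phi @*^-1 K | 'Q)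
    \isog phi @* G / 'C_(phi @* G)(H / K | 'Q).
- move=> nsKG nsHG; have sHG := normal_sub nsHG.
  have nKH := subset_trans sHG (normal_norm nsKG).
  split; last first.
    rewrite cent_factor_morphpre //.
    exact/quotient_morphpre_isog/cent_factor_normal.
  rewrite !card_quotient ?morphpre_norms //.
  by rewrite index_morphpre // (subset_trans sHG) ?morphimS.
split=> [LFphiG H K chiefHK sKerK | LFG H K chiefHK] p p_pr.
  have [nsKG nsHG pKH _] := chief_factorP _ _ _ chiefHK.
  have sKerH := subset_trans sKerK (proper_sub pKH).
  have [K1 nsK1 defK] := normal_over_ker sGD nsKG sKerK.
  have [H1 nsH1 defH] := normal_over_ker sGD nsHG sKerH.
  rewrite defK defH (chief_factor_morphpre sGD) // in chiefHK *.
  have [-> isoC] := factor_isog _ _ nsK1 nsH1 => pHK.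
  apply: isogf p_pr _ _ _ _ _ (LFphiG _ _ chiefHK p p_pr pHK).
  by rewrite isog_sym.
have [nsKG nsHG _ _] := chief_factorP _ _ _ chiefHK.
have [<- isoC] := factor_isog _ _ nsKG nsHG => pHK.
apply: isogf p_pr _ _ _ _ isoC (LFG _ _ _ _ _ p_pr pHK).
  by rewrite (chief_factor_morphpre sGD).
exact: ker_sub_pre.
Qed.

Lemma LF_formation f : local_screen f -> formation (LF f).
Proof.
move=> formf.
have isogf p : prime p -> isog_closed (f p) by case/formf.
split.
- move=> gT rT G H /isogP[phi inj_phi eqH] LFG.
  have <- : (phi @* G)%G = H by apply: group_inj.
  apply/LF_morphim=> // [|K L chiefKL _]; last exact: LFG.
  by rewrite (trivgP inj_phi) sub1G.
- move=> gT G N nsNG LFG.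
  apply/LF_morphim; rewrite ?ker_coset ?normal_norm ?normal_sub //.
  by move=> H K chiefHK _; apply: LFG.
move=> gT G A B nsAG nsBG LFA LFB.
have nsDG := normalI nsAG nsBG.
(* When [H :&: N] lies in [K], the factor [H / K] is [G]-isomorphic to the factor of
   [H <*> (K <*> N)] by [K <*> N], which lies above [N] and so is seen in [G / N]. *)
have LF_quo (N H K : {group gT}) : N <| G -> LF f (G / N)%G ->
  chief_factor G K H -> H :&: N \subset K -> f_central f G K H.
- move=> nsNG LFN chiefHK sHN_K.
  have [nsKG nsHG pKH _] := chief_factorP _ _ _ chiefHK.
  have nsKN := normalY nsKG nsNG.
  have defK : (H :&: (K <*> N))%G = K.
    apply: group_inj; rewrite /= norm_joinEl; last first.
      by rewrite (subset_trans (normal_sub nsKG)) ?normal_norm.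
    by rewrite setIC -group_modl ?proper_sub // setIC mulGSid.
  have := f_central_join f nsHG nsKN; rewrite defK => [[_]]; apply.
  have kerN : 'ker (coset N) \subset G by rewrite ker_coset normal_sub.
  apply: ((LF_morphim isogf (normal_norm nsNG) kerN).1 LFN).
    by rewrite -chief_factor_join // [_ :&: _](congr1 val defK).
  by rewrite ker_coset joing_subr.
apply/LF_morphim; rewrite ?ker_coset ?normal_norm ?normal_sub //.
move=> H K chiefHK sDK.
have [nsKG nsHG pKH maxK] := chief_factorP _ _ _ chiefHK.
have [sHA_K | not_sHA_K] := boolP (H :&: A \subset K).
  exact: (LF_quo A).
have nsHAG := normalI nsHG nsAG.
(* Now [A] covers [H / K], so the factor may be replaced by that of [H :&: A] by [H :&: A :&: K]. It
   is visible in [G / B], because [H :&: A :&: B] lies in [K]. *)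
have defH : ((H :&: A) <*> K)%G = H.
  have [||| eqK | ->] // := maxK ((H :&: A) <*> K)%G.
  - exact: normalY.
  - exact: joing_subr.
  - by rewrite join_subG subsetIl proper_sub.
  by case/negP: not_sHA_K; rewrite -[X in _ \subset gval X]eqK joing_subl.
have := f_central_join f nsHAG nsKG; rewrite defH => [[fC _]]; apply: fC.
apply: (LF_quo B) => //.
  by rewrite chief_factor_join // [_ <*> _](congr1 val defH).
by rewrite subsetI subsetIl -setIA (subset_trans (subsetIr _ _)).
Qed.

(** * Irreducible actions of abelian groups of exponent dividing p - 1 *)

Section Linear.
Import GRing.Theory.
Local Open Scope ring_scope.

(** Every element of [G] has an eigenvalue in [F]; the group acts commutatively, so Schur's lemma
    makes each element a scalar. Then every line is a submodule and the dimension [n.+1] is 1. *)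
Lemma mx_irr_split_linear (F : finFieldType) (gT : finGroupType)
    (G : {group gT}) (n : nat) (rG : mx_representation F G n.+1) :
    mx_irreducible rG -> (G^`(1) \subset rker rG)%g ->
  {in G, forall x, (x ^+ #|F|.-1)%g \in rker rG} -> n = 0%N.
Proof.
move=> irrG abG expG; have [_ fullG] := (mx_irrP rG).1 irrG.
have cent_rG x : x \in G -> centgmx rG (rG x).
  move=> Gx; apply/centgmxP=> y Gy; rewrite -!repr_mxM //.
  have /rkerP[_ rxy] : [~ x, y] \in rker rG by rewrite (subsetP abG) ?mem_commg.
  by rewrite commgC (repr_mxM rG (groupM Gy Gx) (groupR Gx Gy)) rxy mulmx1.
have scalar_rG x : x \in G -> exists a, rG x = a%:M.
  move=> Gx; have /rkerP[_ rx1] := expG x Gx.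
  have cardF_gt0 : (0 < #|F|)%N by apply/card_gt0P; exists 0.
  have rxF : rG x ^+ #|F| = rG x.
    by rewrite -[#|F|]prednK // exprS -repr_mxX // rx1 mulr1.
  have [a /eigenvalueP[v va nzv]] : exists a, eigenvalue (rG x) a.
    (* The product over all of [F] is the polynomial ['X^#|F| - 'X], which kills [rG x]. So the
       minimal polynomial is a product of some of these linear factors, and of at least one since it
       is not constant. *)
    have : (mxminpoly (rG x) %| \prod_(a : F) ('X - a%:P)).
      rewrite -finField_genPoly mxminpoly_min //.
      by rewrite rmorphB rmorphXn /= horner_mx_X rxF subrr.
    case/dvdp_prod_XsubC=> m min_m; have := mxminpoly_nonconstant (rG x).
    have := eqp_size min_m; rewrite -(big_map id predT (fun a => 'X - a%:P)) map_id.
    case def_m: (mask m _) => [|a s] szm.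
      by rewrite size_mxminpoly big_nil size_poly1 in szm; case: szm => ->.
    exists a; rewrite eigenvalue_root_min (eqp_root min_m).
    rewrite -(big_map id predT (fun a => 'X - a%:P)) map_id root_prod_XsubC.
    by rewrite def_m mem_head.
  (* By Schur, [rG x - a%:M] is zero or invertible, and it kills the eigenvector [v]. *)
  exists a; apply/eqP; rewrite -subr_eq0.
  have cxa : centgmx rG (rG x - a%:M).
    apply/centgmxP=> y Gy; rewrite mulmxBl mulmxBr (centgmxP (cent_rG x Gx)) //.
    by rewrite scalar_mxC.
  apply: contraNT nzv => nz; have unit_xa := mx_Schur irrG cxa nz.
  rewrite -(mulmxK unit_xa v) mulmxBr va mul_mx_scalar subrr mul0mx //.
have /fullG : mxmodule rG (delta_mx 0 0 : 'M_n.+1).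
  apply/mxmoduleP=> x /scalar_rG[a ->].
  by rewrite mul_mx_scalar scalemx_sub.
rewrite /row_full mxrank_delta -mxrank_eq0 mxrank_delta => /(_ isT)/eqP[].
by case: (n).
Qed.

End Linear.

Lemma minnormal_split_prime (gT : finGroupType) (p : nat) (V G : {group gT}) :
    minnormal V G -> p.-abelem V -> G^`(1) \subset 'C(V) ->
  {in G, forall x, x ^+ p.-1 \in 'C(V)} -> #|V| = p.
Proof.
move=> minV abelV cVG' expG.
have [/andP[ntV nVG] _] := mingroupP minV.
have [p_pr _ [m cardV]] := pgroup_pdiv (abelem_pgroup abelV) ntV.
pose rG := abelem_repr abelV ntV nVG.
have irrG : mx_irreducible rG by apply/abelem_mx_irrP.
have dim0 : abelem_dim' V = 0%N.
  apply: (mx_irr_split_linear irrG).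
    by rewrite rker_abelem subsetI der_sub.
  move=> x Gx; rewrite rker_abelem card_Fp // inE groupX //=.
  exact: expG.
have := dim_abelemE abelV ntV; rewrite dim0 cardV pfactorK // => - [<-].
by rewrite expn1.
Qed.

(** * Modular subgroups *)

(** In both modular identities one inclusion holds for arbitrary subgroups; only the other one is
    kept. *)
Lemma modularP (gT : finGroupType) (M G : {group gT}) :
  reflect [/\ M \subset G,
              forall X Z : {group gT}, Z \subset G -> X \subset Z ->
                (X <*> M) :&: Z \subset X <*> (M :&: Z) &
              forall Y Z : {group gT}, Y \subset G -> Z \subset G -> M \subset Z ->
                (M <*> Y) :&: Z \subset M <*> (Y :&: Z)]
          (modular M G).
Proof.
have joinI (X A Z : {group gT}) : X \subset Z ->
    (X <*> (A :&: Z) == (X <*> A) :&: Z) = ((X <*> A) :&: Z \subset X <*> (A :&: Z)).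
  move=> sXZ; rewrite eqEsubset andb_idl // => _.
  by rewrite subsetI join_subG sXZ subsetIr genS ?setUS ?subsetIl.
apply: (iffP and3P) => [] [sMG modM modM'].
  split=> // X Z.
    move=> sZG sXZ; rewrite -joinI //; have /forallP/(_ Z)/implyP := forallP modM X.
    by apply; rewrite sZG sXZ (subset_trans sXZ).
  move=> sYG sZG sMZ; rewrite -joinI //; have /forallP/(_ Z)/implyP := forallP modM' X.
  by apply; rewrite sYG sZG sMZ.
split=> //.
  apply/forallP=> X; apply/forallP=> Z; apply/implyP=> /and3P[_ sZG sXZ].
  by rewrite joinI // modM.
apply/forallP=> Y; apply/forallP=> Z; apply/implyP=> /and3P[sYG sZG sMZ].
by rewrite joinI // modM'.
Qed.

Section Modular.

Variable gT : finGroupType.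
Implicit Types G M N : {group gT}.

Lemma normal_modular N G : N <| G -> modular N G.
Proof.
case/andP=> sNG nNG; apply/modularP; split=> // X Z.
  move=> sZG sXZ; have sXG := subset_trans sXZ sZG.
  have [nNX nZX] := (subset_trans sXG nNG, subset_trans sXZ (normG Z)).
  by rewrite !norm_joinEl ?normsI // group_modl.
move=> sXG sZG sNZ; have nNX := subset_trans sXG nNG.
by rewrite !norm_joinEr ?(subset_trans (subsetIl X Z)) // group_modl.
Qed.

Lemma quotient_modular N M G :
  N <| G -> N \subset M -> M \subset G -> modular (M / N) (G / N) -> modular M G.
Proof.
move=> nsNG sNM sMG /modularP[_ modM modM']; have nNG := normal_norm nsNG.
have nN H : H \subset G -> H \subset 'N(N) := fun sHG => subset_trans sHG nNG.
apply/modularP; split=> // X Z.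
  move=> sZG sXZ; have sXG := subset_trans sXZ sZG.
  have sWZ : X <*> (M :&: Z) \subset Z by rewrite join_subG sXZ subsetIr.
  have := modM (X / N)%G (Z / N)%G (quotientS _ sZG) (quotientS _ sXZ).
  have nNMZ : M :&: Z \subset 'N(N) by rewrite subIset ?nN.
  rewrite /= -[M / N :&: _]quotientGI // -!quotientY ?(nN X) ?(nN M) //.
  move/(subset_trans (quotientI _ _ _)).
  rewrite (quotientSK _ (subset_trans (subsetIr _ Z) (nN Z sZG))) => sNW.
  (* [Z] need not contain [N], so the law in [G / N] leaves a spare factor [N]. Cutting with [Z]
     reduces it to [N :&: Z], which lies in [M :&: Z]. *)
  have: (X <*> M) :&: Z \subset (N * (X <*> (M :&: Z))) :&: Z by rewrite subsetI sNW subsetIr.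
  rewrite -normC ?(subset_trans sWZ) ?nN // -group_modl //.
  by rewrite mulGSid // (subset_trans _ (joing_subr _ _)) ?setSI.
move=> sXG sZG sMZ.
have := modM' (X / N)%G (Z / N)%G (quotientS _ sXG) (quotientS _ sZG) (quotientS _ sMZ).
have nNXZ : X :&: Z \subset 'N(N) by rewrite subIset ?nN.
rewrite /= -[X / N :&: _]quotientIG ?(subset_trans sNM) // -!quotientY ?(nN X) ?(nN M) //.
move/(subset_trans (quotientI _ _ _)).
rewrite (quotientSK _ (subset_trans (subsetIr _ Z) (nN Z sZG))) mulSGid //.
by rewrite (subset_trans sNM) ?joing_subl.
Qed.

End Modular.

(** Meant for the order and indices along a chain of subgroups from 1 to a group of order [p * q]:
    of three steps one is trivial. *)
Lemma prime_mul2_eq_mul3 p q x y z :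
  prime p -> prime q -> (p * q = x * y * z)%N -> [\/ x = 1%N, y = 1%N | z = 1%N].
Proof.
have prime_mul3 r a b c : prime r -> (r = a * b * c)%N -> b = 1%N \/ c = 1%N.
  move=> r_pr def_r; have [|b1] := eqVneq b 1%N; first by left.
  have /(prime_nt_dvdP r_pr b1) eb : b %| r by rewrite def_r mulnAC dvdn_mull.
  right; apply/eqP; rewrite -dvdn1 -(dvdn_pmul2l (prime_gt0 r_pr)) muln1.
  by rewrite {2}def_r -eb -mulnA dvdn_mull.
move=> p_pr q_pr def_pq; have p0 := prime_gt0 p_pr.
have: p %| x * y * z by rewrite -def_pq dvdn_mulr.
rewrite !Euclid_dvdM // => /orP[/orP[]|] /dvdnP[k def_k]; move/eqP: def_pq; rewrite def_k.
- rewrite (_ : k * p * y * z = p * (k * y * z))%N; last by rewrite -!mulnA mulnCA.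
  rewrite eqn_pmul2l // => /eqP/(prime_mul3 _ _ _ _ q_pr)[]->; [exact: Or32 | exact: Or33].
- rewrite (_ : x * (k * p) * z = p * (k * x * z))%N; last first.
    by rewrite mulnA (mulnC _ p) -!mulnA (mulnCA x).
  rewrite eqn_pmul2l // => /eqP/(prime_mul3 _ _ _ _ q_pr)[]->; [exact: Or31 | exact: Or33].
rewrite (_ : x * y * (k * p) = p * (k * x * y))%N; last first.
  by rewrite mulnA (mulnC _ p) (mulnC _ k) !mulnA.
by rewrite eqn_pmul2l // => /eqP/(prime_mul3 _ _ _ _ q_pr)[]->; [exact: Or31 | exact: Or32].
Qed.

(** The subgroup lattice has length 2, so in each modular law the lower group is trivial, or equals
    [Z], or [Z] is [G]. Each case is immediate. *)
Lemma card_mul2_modular (gT : finGroupType) (M G : {group gT}) p q :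
  prime p -> prime q -> #|G| = (p * q)%N -> M \subset G -> modular M G.
Proof.
move=> p_pr q_pr cardG sMG; apply/modularP.
have chain (A B : {group gT}) : A \subset B -> B \subset G -> [\/ A :=: 1, A :=: B | B :=: G].
  move=> sAB sBG; have := prime_mul2_eq_mul3 (x := #|A|) p_pr q_pr.
  rewrite -cardG -(Lagrange sBG) -(Lagrange sAB) => /(_ _ _ erefl)[A1 | eAB | eBG].
  - by apply: Or31; apply: card1_trivg.
  - by apply: Or32; apply/eqP; rewrite eqEsubset sAB -indexg_eq1 eAB.
  by apply: Or33; apply/eqP; rewrite eqEsubset sBG -indexg_eq1 eBG.
split=> // X Z.
  move=> sZG sXZ; have [-> | -> | ->] := chain X Z sXZ sZG.
  - by rewrite !joing1G.
  - by rewrite subIset // joing_subl orbT.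
  - by rewrite (setIidPl sMG) subsetIl.
move=> sYG sZG sMZ; have [M1|->|->] := chain M Z sMZ sZG.
- by rewrite M1 !joing1G.
- by rewrite subIset // joing_subl orbT.
by rewrite (setIidPl sYG) subsetIl.
Qed.

(** Either [M] equals the normal subgroup [D], or [G / D] has order a product of two primes. *)
Lemma prime_index_modular (gT : finGroupType) (M G D : {group gT}) p :
    D <| G -> D \subset M -> M \subset G -> prime p -> prime #|G : M| ->
  #|M : D| %| p -> modular M G.
Proof.
move=> nsDG sDM sMG p_pr iGM; have nDG := normal_norm nsDG.
have [/eqP|i1] := eqVneq #|M : D| 1%N.
  rewrite indexg_eq1 => sMD _; have/group_inj -> : M :=: D; last exact: normal_modular.
  by apply/eqP; rewrite eqEsubset sMD.
move/(prime_nt_dvdP p_pr i1)=> iMD.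
apply: (quotient_modular nsDG) => //; apply: card_mul2_modular iGM p_pr _ _.
  by rewrite card_quotient // -(Lagrange_index sMG sDM) -iMD.
exact: quotientS.
Qed.

(** Shows that no subgroup lies strictly between the centraliser of [A / B] in [M] and [M], when the
    modular subgroup [M] avoids this factor of prime order. *)
Lemma modular_complement (gT : finGroupType) (M L A B E : {group gT}) :
    modular M L -> A <| L -> B <| L -> B \subset A -> prime #|A : B| ->
    M :&: A \subset B -> E \subset M ->
    M :&: 'C_L(A / B | 'Q) \subset E ->
  E \subset 'C_L(A / B | 'Q) \/ E :=: M.
Proof.
move=> /modularP[sML modM _] nsAL nsBL sBA prAB sMA_B sEM sCE.
set C := 'C_L(A / B | 'Q) in sCE *.
have [[sAL nAL] [sBL nBL]] := (andP nsAL, andP nsBL).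
have [nBA sEL] := (subset_trans sAL nBL, subset_trans sEM sML).
have [v Av notBv] : exists2 v, v \in A & v \notin B.
  by apply/subsetPn/negP => sAB; move: prAB; rewrite -indexg_eq1 in sAB; rewrite (eqP sAB).
have [Lv nBv] := (subsetP sAL v Av, subsetP nBA v Av).
have between (Y : {group gT}) : B \subset Y -> Y \subset A -> ~~ (Y \subset B) -> A \subset Y.
  move=> sBY sYA; rewrite -!indexg_eq1 => ntY; move: prAB.
  rewrite -(Lagrange_index sYA sBY) => /primeP[_ /(_ _ (dvdn_mull _ (dvdnn _)))].
  rewrite (negPf ntY) /= => /eqP/esym/eqP.
  by rewrite -{2}[#|Y : B|]mul1n eqn_pmul2r.
have genAB : A / B = <[coset B v]>.
  rewrite -quotient_cycle //; apply/eqP; rewrite eqEsubset andbC quotientS ?cycle_subG //=.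
  rewrite quotientSK // -norm_joinEr ?cycle_subG //.
  by rewrite between ?joing_subl ?join_subG ?sBA ?cycle_subG ?negb_and ?notBv ?orbT.
have centP x : x \in L -> (x \in C) = ([~ x, v] \in B).
  move=> Lx; have nBx := subsetP nBL x Lx.
  rewrite inE Lx astabQ genAB cent_cycle inE nBx inE /= (sameP cent1P commgP).
  by rewrite -morphR // (sameP eqP (kerP (coset B) (groupR nBx nBv))) ker_coset.
have [?|nCE] := boolP (E \subset C); [by left | right].
have {nCE} [e Ee nCe] := subsetPn nCE.
have [Me Le] := (subsetP sEM e Ee, subsetP sEL e Ee).
(* Modulo B, M and M ^ v are distinct complements of A meeting in the
   centraliser of v, whereas E ^ v and M already generate v. *)
pose X := ((E :^ v) <*> B)%G; pose Z := ((M :^ v) <*> B)%G.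
have sXZ : X \subset Z by rewrite genS ?setSU ?conjSg.
have sZL : Z \subset L by rewrite join_subG sBL -(conjGid Lv) conjSg sML.
(* The commutator [[~ e, v]] is a product of [e^-1] in [M] and [e ^ v] in [X]; it lies in [A] but
   not in [B], and nothing lies strictly between [B] and [A]. *)
have sAXM : A \subset X <*> M.
  have: A \subset (X <*> M) :&: A.
    apply: between; rewrite ?subsetIr //.
      by rewrite subsetI sBA andbT (subset_trans (joing_subr (E :^ v) B)) ?joing_subl.
    apply/subsetPn; exists [~ e, v]; last by rewrite -centP.
    rewrite inE; apply/andP; split; last first.
      by rewrite (subsetP _ _ (mem_commg Le Av)) // commg_subr.
    rewrite groupM ?groupV //; first by rewrite mem_gen // inE Me orbT.
    by rewrite mem_gen // inE mem_gen // inE memJ_conjg Ee.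
  by rewrite subsetI => /andP[].
have sZXM : Z \subset X <*> M.
  rewrite join_subG (subset_trans sBA) // andbT -(conjGid (subsetP sAXM v Av)) conjSg.
  exact: joing_subr.
have nBE : E :^ v \subset 'N(B) by rewrite (subset_trans _ nBL) // -(conjGid Lv) conjSg.
have nBM : M :^ v \subset 'N(B) by rewrite (subset_trans _ nBL) // -(conjGid Lv) conjSg.
(* If [m = m1 ^ v * b], then [[~ m1, v] * b = m1^-1 * m] lies in [M :&: A], hence in [B]. So [m1]
   centralises [A / B], and thus belongs to [E]. *)
have sMZX : M :&: Z \subset X.
  apply/subsetP=> m /setIP[Mm]; rewrite /= norm_joinEl //.
  case/mulsgP=> _ b /imsetP[m1 Mm1 ->] Bb def_m.
  have Lm1 := subsetP sML m1 Mm1.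
  have Bm1v : [~ m1, v] \in B.
    rewrite -(groupMr _ Bb) (subsetP sMA_B) // inE; apply/andP; split.
      by rewrite commgEl -mulgA -def_m groupM ?groupV.
    by rewrite groupM ?(subsetP sBA b Bb) // (subsetP _ _ (mem_commg Lm1 Av)) // commg_subr.
  rewrite def_m /X /= norm_joinEl // mem_mulg // memJ_conjg (subsetP sCE) // inE Mm1.
  by rewrite centP.
have := modM X Z sZL sXZ; rewrite (setIidPr sZXM) (joing_idPl sMZX) => sZX.
apply/eqP; rewrite eqEsubset sEM; apply/subsetP=> m Mm.
have: m ^ v \in X by rewrite (subsetP sZX) // mem_gen // inE memJ_conjg Mm.
rewrite /= norm_joinEl // => /mulsgP[_ b /imsetP[e1 Ee1 ->] Bb def_mv].
(* Conjugating back, the second factor lies in [M :&: B]; it centralises [A / B], so it belongs to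
   [E]. *)
have def_m : m = e1 * b ^ v^-1 by rewrite -(conjgK v m) def_mv conjMg conjgK.
have Bbv : b ^ v^-1 \in B by rewrite memJ_norm ?groupV.
rewrite def_m groupM // (subsetP sCE) // inE centP ?(subsetP sBL) //.
rewrite -(groupMl _ (subsetP sEM e1 Ee1)) -def_m Mm /=.
by rewrite commgEl groupM ?groupV // memJ_norm.
Qed.

(** * The screen of the strongly supersoluble groups *)

Lemma formationI (F1 F2 : group_class) :
  formation F1 -> formation F2 -> formation (classI F1 F2).
Proof.
case=> [isoF1 quoF1 resF1] [isoF2 quoF2 resF2]; split.
- by move=> gT rT G H isoGH [F1G F2G]; split; [apply: isoF1 F1G | apply: isoF2 F2G].
- by move=> gT G N nsNG [F1G F2G]; split; [apply: quoF1 | apply: quoF2].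
by move=> gT H A B nsA nsB [? ?] [? ?]; split; [apply: resF1 | apply: resF2].
Qed.

Lemma abelian_quotientI (gT : finGroupType) (H A B : {group gT}) :
  A <| H -> B <| H -> abelian (H / A) -> abelian (H / B) -> abelian (H / (A :&: B)).
Proof.
case/andP=> _ nAH /andP[_ nBH] abA abB.
by rewrite sub_der1_abelian // subsetI !der1_min.
Qed.

Lemma exponent_quotientI (gT : finGroupType) (H A B : {group gT}) :
    A <| H -> B <| H ->
  exponent (H / (A :&: B)) %| lcmn (exponent (H / A)) (exponent (H / B)).
Proof.
case/andP=> _ nAH /andP[_ nBH]; apply/exponentP=> _ /morphimP[x nABx Hx ->].
have in_ker (N : {group gT}) n :
  H \subset 'N(N) -> exponent (H / N) %| n -> x ^+ n \in N.
- move=> nNH /exponentP expN; have nNx := subsetP nNH x Hx.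
  by apply: coset_idr; rewrite ?groupX // morphX // expN // mem_quotient.
rewrite -morphX //= coset_id // inE.
by rewrite !in_ker ?dvdn_lcml ?dvdn_lcmr.
Qed.

Lemma abelian_exponent_dvd_formation n : formation (abelian_exponent_dvd n).
Proof.
split.
- move=> gT rT G H isoGH [abG eG]; split; first by rewrite -(isog_abelian isoGH).
  by rewrite -(exponent_isog isoGH).
- move=> gT G N nsNG [abG eG]; split; first exact: quotient_abelian.
  exact: dvdn_trans (exponent_quotient _ _) eG.
move=> gT H A B nsA nsB [abA eA] [abB eB]; split; first exact: abelian_quotientI.
by apply: dvdn_trans (exponent_quotientI nsA nsB) _; rewrite dvdn_lcm eA.
Qed.

Lemma abelian_squarefree_exponent_formation : formation abelian_squarefree_exponent.
Proof.
split.
- move=> gT rT G H isoGH [abG eG]; split; first by rewrite -(isog_abelian isoGH).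
  by rewrite -(exponent_isog isoGH).
- move=> gT G N nsNG [abG eG]; split=> [|q q_pr]; first exact: quotient_abelian.
  by apply: contra (eG q q_pr) => /dvdn_trans; apply; apply: exponent_quotient.
move=> gT H A B nsA nsB [abA eA] [abB eB]; split=> [|q q_pr]; first exact: abelian_quotientI.
apply/negP=> /dvdn_trans/(_ (exponent_quotientI nsA nsB)).
(* The [q]-adic valuation of an lcm is the larger of the two, so [q ^ 2] would already divide one of
   the exponents. *)
rewrite pfactor_dvdn ?lcmn_gt0 ?exponent_gt0 // logn_lcm ?exponent_gt0 //.
by rewrite leq_max -!pfactor_dvdn ?exponent_gt0 // (negPf (eA q q_pr)) (negPf (eB q q_pr)).
Qed.

(** * Chief factors of prime order and supersolubility *)

Section PrimeFactors.

Variable gT : finGroupType.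
Implicit Types G H K U : {group gT}.

(** Conjugation embeds the quotient in the automorphism group of a group of prime order [r], which
    is cyclic of order [r.-1]. *)
Lemma prime_factor_automizer G H K :
    K <| G -> H <| G -> prime #|H / K| ->
  cyclic (G / 'C_G(H / K | 'Q)) /\ #|G / 'C_G(H / K | 'Q)| %| #|H / K|.-1.
Proof.
move=> nsKG nsHG prHK.
have sGN : G \subset coset K @*^-1 'N(H / K).
  rewrite -sub_morphim_pre ?(normal_norm nsKG) //.
  by rewrite [_ \subset _]quotient_norms ?(normal_norm nsHG).
have := first_isog_loc (conj_aut (H / K) \o coset K) sGN.
rewrite ker_comp ker_conj_aut -astabQ morphim_comp => isoC.
rewrite (isog_cyclic isoC) (card_isog isoC).
have sAut := Aut_conj_aut (H / K) (coset K @* G).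
split; first exact: cyclicS sAut (Aut_prime_cyclic prHK).
rewrite -totient_prime // -card_Aut_cyclic ?prime_cyclic //.
exact: cardSg sAut.
Qed.

Lemma chief_cyclic_prime G H K :
  chief_factor G K H -> cyclic (H / K) -> prime #|H / K|.
Proof.
move=> chiefHK cycHK.
have solHK := abelian_sol (cyclic_abelian cycHK).
have [_ ntHK /is_abelemP[p p_pr abelHK]] :=
  minnormal_solvable (chief_factor_minnormal chiefHK) (subxx _) solHK.
by rewrite (cyclic_abelem_prime abelHK).
Qed.

(** Used on chains of subgroups, with [t] inclusion, to find a step at which a chief factor stops
    being avoided. *)
Lemma path_crossing (T : Type) (e t : rel T) (P : pred T) x s :
    reflexive t -> transitive t -> subrel e t ->
    path e x s -> ~~ P x -> P (last x s) ->
  exists a b, [/\ e a b, t x a, t b (last x s), ~~ P a & P b].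
Proof.
move=> t_refl t_trans sub_et.
have t_last y s' : path e y s' -> t y (last y s').
  by elim: s' y => //= z s' IHs y /andP[/sub_et/t_trans ? /IHs]; auto.
elim: s x => [|y s IHs] x /=; first by move=> _ /negPf->.
case/andP=> exy es nPx Plast; have [Py | nPy] := boolP (P y).
  by exists x, y; split=> //; apply: t_last.
have [a [b [? tya ? ? ?]]] := IHs y es nPy Plast.
by exists a, b; split=> //; apply: t_trans (sub_et _ _ exy) tya.
Qed.

Lemma chief_join_cover G H K U : 
    chief_factor G K H -> U <| G -> ~~ (U :&: H \subset K) ->
  (U :&: H) <*> K = H.
Proof.
case/chief_factorP=> nsKG nsHG pKH maxK nsUG nUHK.
have [||| eqK | eqH] := maxK ((U :&: H) <*> K)%G.
- by rewrite normalY ?normalI.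
- exact: joing_subr.
- by rewrite join_subG subsetIr proper_sub.
- by case/negP: nUHK; rewrite -[X in _ \subset gval X]eqK joing_subl.
exact: congr1 eqH.
Qed.

(** At the step from [V] to [U] of the cyclic series where [H / K] becomes covered, [H / K] is an
    image of [(U :&: H) / (V :&: H)], which embeds in the cyclic group [U / V]. *)
Lemma supersoluble_chief_cyclic G H K :
  supersoluble G -> chief_factor G K H -> cyclic (H / K).
Proof.
case=> s Gs lastG chiefHK; have [nsKG nsHG pKH _] := chief_factorP _ _ _ chiefHK.
have [] := @path_crossing _ _ (fun A B : {group gT} => A \subset B)
  (fun U : {group gT} => ~~ (U :&: H \subset K)) _ _ _ _ _ Gs.
- by move=> A /=.
- by move=> B A C; apply: subset_trans.
- by move=> A B /= /and4P[].
- by rewrite /= negbK (subset_trans (subsetIl _ _)) ?sub1G.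
- by rewrite lastG (setIidPr (normal_sub nsHG)) proper_subn.
move=> V [U [/and4P[nsVG nsUG sVU cycUV] _ _]] /negPn sVHK nsUHK.
have defH := chief_join_cover chiefHK nsUG nsUHK.
pose D := (U :&: H)%G; rewrite -[_ :&: _]/(gval D) in defH.
have sDG : D \subset G by rewrite subIset ?normal_sub.
have nN (N : {group gT}) : N <| G -> D \subset 'N(N).
  by move=> nsNG; rewrite (subset_trans sDG) ?normal_norm.
rewrite -defH quotientYidr ?nN //.
have cycDV : cyclic (D / V) by rewrite (cyclicS _ cycUV) ?quotientS ?subsetIl.
have cycDVD : cyclic (D / (V :&: D)).
  by rewrite (isog_cyclic (second_isog (nN V nsVG))).
rewrite -(isog_cyclic (second_isog (nN K nsKG))).
have sVK : V :&: D \subset K :&: D.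
  rewrite subsetI subsetIr andbT (subset_trans _ sVHK) // setIS // subsetIr //.
have [nVD nKD] : D \subset 'N(V :&: D) /\ D \subset 'N(K :&: D).
  by rewrite !normsI ?nN ?normG.
have /homgP[f im_f] := homg_quotientS nVD nKD sVK.
by rewrite /= -im_f morphim_cyclic.
Qed.

Lemma chief_cyclic_supersoluble G :
    (forall H K : {group gT}, chief_factor G K H -> cyclic (H / K)) ->
  supersoluble G.
Proof.
move=> cycG; have [s chief_s lastG] := chief_series_exists (normal_refl G).
exists s => //; apply: sub_path chief_s => K H chiefHK.
have [nsKG nsHG pKH _] := chief_factorP _ _ _ chiefHK.
by apply/and4P; split; rewrite ?proper_sub // cycG.
Qed.

Lemma central_chief_prime G H K :
    chief_factor G K H ->
    (forall p, prime p -> p %| #|H / K| ->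
      abelian_exponent_dvd p.-1 (G / 'C_G(H / K | 'Q))%G) ->
  prime #|H / K|.
Proof.
move=> chiefHK centHK; have [nsKG nsHG pKH _] := chief_factorP _ _ _ chiefHK.
have minHK := chief_factor_minnormal chiefHK.
have [/andP[ntHK _] _] := mingroupP minHK.
set C := 'C_G(H / K | 'Q)%G in centHK.
have nsCG : C <| G := cent_factor_normal nsKG nsHG.
have nCG := normal_norm nsCG; have nKG := normal_norm nsKG.
have sG'C : G^`(1) \subset C.
  have [] := centHK (pdiv #|H / K|).
  - by rewrite pdiv_prime // cardG_gt1.
  - exact: pdiv_dvd.
  by move=> abG _; apply: der1_min.
have cHKG' : (G / K)^`(1) \subset 'C(H / K).
  rewrite -quotient_der // quotient_cents2r //.
  by rewrite -(sub_cent_factor nsKG nsHG) ?der_sub.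
have sHKG := quotientS K (normal_sub nsHG).
(* The derived subgroup of [G] centralises [H / K], so that of [H / K] is central in it and the
   second one is trivial. *)
have solHK : solvable (H / K).
  apply/derivedP; exists 2; apply/commG1P.
  exact: subset_trans (dergS 1 sHKG) (subset_trans cHKG' (centS (der_sub 1 _))).
have [_ _ /is_abelemP[p p_pr abelHK]] := minnormal_solvable minHK (subxx _) solHK.
have [_ pHK _] := pgroup_pdiv (abelem_pgroup abelHK) ntHK.
rewrite (minnormal_split_prime minHK abelHK) //.
move=> _ /morphimP[x nKx Gx ->]; have [_ /exponentP expG] := centHK p p_pr pHK.
have: x ^+ p.-1 \in C.
  apply: coset_idr; first by rewrite groupX // (subsetP nCG).
  by rewrite morphX ?(subsetP nCG) // expG // mem_quotient.
by rewrite /= astabQ => /setIP[_ /morphpreP[_]]; rewrite morphX.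
Qed.

End PrimeFactors.

(** * Sylow subgroups and submodular chains *)

Section SylowModular.

Variable gT : finGroupType.
Implicit Types G H K L M P Q : {group gT}.

Lemma Sylow_join_modular G H K P p :
    prime p -> P \in 'Syl_p(G) -> K <| G -> H <| G -> K \subset H -> prime #|H / K| ->
    abelian_squarefree_exponent (G / 'C_G(H / K | 'Q))%G ->
  modular (P <*> K) (P <*> H).
Proof.
move=> p_pr; rewrite inE => sylP nsKG nsHG sKH prHK [_ sqf].
have [cycGC _] := prime_factor_automizer nsKG nsHG prHK.
have [[sKG nKG] [sHG nHG]] := (andP nsKG, andP nsHG).
set C := 'C_G(H / K | 'Q)%G in sqf cycGC.
have nsCG : C <| G := cent_factor_normal nsKG nsHG; have [_ nCG] := andP nsCG.
have sPG := pHall_sub sylP; have pP := pHall_pgroup sylP.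
pose M := (P <*> K)%G; pose L := (P <*> H)%G.
rewrite -[modular _ _]/(modular M L).
have sMG : M \subset G by rewrite join_subG sPG.
have sLG : L \subset G by rewrite join_subG sPG.
have sML : M \subset L by rewrite genS ?setUS.
have sKM : K \subset M := joing_subr _ _; have sHL : H \subset L := joing_subr _ _.
have sKC : K \subset C by rewrite sub_cent_factor // commg_subl (subset_trans sHG).
pose D := (M :&: C)%G.
(* [P] normalises both [M] and [C], while [H] normalises [D] because [D] centralises [H / K], so
   that [[~: D, H]] lies in [K], hence in [D]. *)
have nsDL : D <| L.
  apply/andP; split; first by rewrite subIset ?sML.
  rewrite join_subG; apply/andP; split.
    apply: (subset_trans (joing_subl P K)); rewrite /D /= normsI ?normG //.
    exact: subset_trans nCG.
  rewrite -commg_subr commGC; apply: (@subset_trans _ _ K); last exact/subsetIP.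
  by rewrite -(sub_cent_factor nsKG nsHG) ?subsetIr // subIset ?sMG.
have iLM : #|L : M| %| #|H / K|.
  have defL : L :=: M * H.
    by rewrite -norm_joinEl ?(subset_trans sMG) //= -joingA (joing_idPr sKH).
  have -> : #|L : M| = #|H : M|.
    by apply/eqP; rewrite -(eqn_pmul2l (cardG_gt0 M)) Lagrange // LagrangeMl defL.
  rewrite card_quotient ?(subset_trans sHG) // -indexgI.
  by rewrite -(Lagrange_index (subsetIl H M)) ?dvdn_mulr // subsetI sKH.
have [/eqP|i1] := eqVneq #|L : M| 1%N.
  rewrite indexg_eq1 => sLM; apply: normal_modular.
  by rewrite /normal sML (subset_trans sLM) ?normG.
apply: (@prime_index_modular _ M L D p) => //; first exact: subsetIl.
  by rewrite (prime_nt_dvdP prHK i1 iLM).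
rewrite indexgI -card_quotient ?(subset_trans sMG) //.
have -> : M / C = P / C.
  by rewrite quotientY ?(subset_trans _ nCG) // (quotientS1 sKC) joingG1.
have nCP := subset_trans sPG nCG.
have [k cardPC] := p_natP (quotient_pgroup C pP : p.-nat #|P / C|).
have cycPC : cyclic (P / C) := cyclicS (quotientS C sPG) cycGC.
(* [P / C] is a cyclic [p]-group, so its order is its exponent and divides a squarefree number: it
   is 1 or [p]. *)
have := exponentS (quotientS C sPG); rewrite (exponent_cyclic cycPC) cardPC.
case: k {cardPC} => [|[|k]] // /(dvdn_trans _) dvd_exp.
by case/negP: (sqf p p_pr); apply: dvd_exp; rewrite dvdn_exp2l.
Qed.

Lemma central_Sylow_submodular G P p :
    prime p -> P \in 'Syl_p(G) ->
    (forall H K, chief_factor G K H -> prime #|H / K| /\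
      abelian_squarefree_exponent (G / 'C_G(H / K | 'Q))%G) ->
  submodular P G.
Proof.
move=> p_pr sylP centG.
have [s chief_s lastG] := chief_series_exists (normal_refl G).
pose f (N : {group gT}) := (P <*> N)%G.
have fP : f 1%G = P by apply: group_inj; rewrite /= joingG1.
exists (map f s); last first.
  rewrite -{1}fP last_map lastG; apply: group_inj; apply/joing_idPr.
  by move: sylP; rewrite inE => /pHall_sub.
rewrite -{1}fP path_map; apply: sub_path chief_s => K H /= chiefHK.
have [nsKG nsHG pKH _] := chief_factorP _ _ _ chiefHK.
have [prHK sqf] := centG H K chiefHK.
by apply: Sylow_join_modular p_pr sylP _ _ _ _ sqf => //; apply: proper_sub.
Qed.

(** [H / K] is replaced by the isomorphic factor [A / B] inside [L], to which [modular_complement]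
    applies. It makes the nontrivial quotient of [M] simple; being also cyclic, this has prime
    order. *)
Lemma modular_quotient_prime G H K L M :
    K <| G -> H <| G -> prime #|H / K| -> L \subset G ->
    modular M L -> M :&: H \subset K -> ~~ (L :&: H \subset K) ->
  M \subset 'C_G(H / K | 'Q) \/ prime #|M / 'C_G(H / K | 'Q)|.
Proof.
move=> nsKG nsHG prHK sLG modML sMHK nLHK.
have [[sKG nKG] [sHG nHG]] := (andP nsKG, andP nsHG).
have [cycGC _] := prime_factor_automizer nsKG nsHG prHK.
set C := 'C_G(H / K | 'Q)%G.
have nsCG : C <| G := cent_factor_normal nsKG nsHG; have [_ nCG] := andP nsCG.
have sML : M \subset L by case/modularP: modML.
have sMG := subset_trans sML sLG.
pose A := (L :&: H)%G; pose B := (A :&: K)%G.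
have nKA : A \subset 'N(K) by rewrite subIset ?(subset_trans sLG).
have eqAK : A / K = H / K.
  apply/eqP; rewrite eqEcard quotientS ?subsetIr //=.
  have ntAK : #|A / K| != 1%N by rewrite -trivg_card1 -subG1 quotient_sub1.
  by rewrite (prime_nt_dvdP prHK ntAK (cardSg (quotientS K (subsetIr L H)))).
have prAB : prime #|A : B| by rewrite indexgI -card_quotient // eqAK.
have [sAL nAL] : A \subset L /\ L \subset 'N(A).
  by rewrite subsetIl normsI ?normG ?(subset_trans sLG).
have nsAL : A <| L by apply/andP.
have nsBL : B <| L.
  by rewrite /normal (subset_trans (subsetIl A K)) //= normsI // (subset_trans sLG).
have eqC (X : {set gT}) : X \subset L -> (X \subset 'C_L(A / B | 'Q)) = (X \subset C).
  move=> sXL; have sXG := subset_trans sXL sLG.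
  rewrite sub_cent_factor // subsetI (subset_trans (commSg A sXL)) ?commg_subr //=.
  rewrite -(sub_astabQR (subset_trans sXG nKG) nKA) eqAK.
  by rewrite [RHS]subsetI sXG.
have sMAB : M :&: A \subset B.
  by rewrite subsetI subsetIr (subset_trans _ sMHK) // setIS ?subsetIr.
have [sMC | nMC] := boolP (M \subset C); [by left | right].
have nCM := subset_trans sMG nCG; have isoMC := second_isog nCM.
rewrite -(card_isog isoMC); apply: simple_sol_prime.
  rewrite (isog_sol isoMC) (solvableS (quotientS C sMG)) //.
  exact/abelian_sol/cyclic_abelian.
rewrite quotient_simple; last by rewrite /normal subsetIr normsI ?normG.
apply/maxgroupP; rewrite properE subsetIr subsetI subxx andbT nMC normsI ?normG //.
split=> // E /andP[/andP[sEM nME] _] sCME.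
have [|sEC | defE] := modular_complement modML nsAL nsBL (subsetIl _ _) prAB sMAB sEM.
- apply: subset_trans sCME; rewrite subsetI subsetIl andbT -eqC ?subsetIr //.
  by rewrite subIset ?sML.
- by apply/eqP; rewrite eqEsubset sCME subsetI sEM -eqC ?sEC ?(subset_trans sEM).
by rewrite defE subxx in nME.
Qed.

Lemma Sylow_submodular_squarefree G H K :
    chief_factor G K H -> prime #|H / K| -> 
    (forall q Q, prime q -> Q \in 'Syl_q(G) -> submodular Q G) ->
  abelian_squarefree_exponent (G / 'C_G(H / K | 'Q))%G.
Proof.
move=> chiefHK prHK subG; have [nsKG nsHG pKH _] := chief_factorP _ _ _ chiefHK.
have [[sKG nKG] [sHG nHG]] := (andP nsKG, andP nsHG).
have [cycGC dvdGC] := prime_factor_automizer nsKG nsHG prHK.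
set C := 'C_G(H / K | 'Q)%G in cycGC dvdGC *.
have nsCG : C <| G := cent_factor_normal nsKG nsHG; have [_ nCG] := andP nsCG.
split=> [|q q_pr]; first exact: cyclic_abelian.
apply/negP=> q2_exp; have q2_GC := dvdn_trans q2_exp (exponent_dvdn _).
have [Q sylQ] := Sylow_exists q G.
have sQG := pHall_sub sylQ.
have [s Qs lastG] : submodular Q G by apply: (subG q) => //; rewrite inE.
have q_GC : q %| #|G / C| by apply: dvdn_trans q2_GC; apply: dvdn_mulr.
(* [q] divides [#|H / K|.-1], so it differs from the prime [#|H / K|] and a [q]-subgroup avoids
   [H / K]. *)
have sQHK : Q :&: H \subset K.
  have nKQH : Q :&: H \subset 'N(K) by rewrite subIset ?(subset_trans sQG).
  rewrite -quotient_sub1 // subG1 trivg_card1; apply/eqP.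
  have coqHK : coprime q #|H / K|.
    rewrite prime_coprime // dvdn_prime2 //; apply/eqP=> eq_q.
    have := dvdn_trans q_GC dvdGC.
    by rewrite -eq_q gtnNdvd // -?subn1 ?subn_gt0 ?prime_gt1 // subn1 ltn_predL prime_gt0.
  have qQHK := quotient_pgroup K (pgroupS (subsetIl Q H) (pHall_pgroup sylQ)).
  have sQHKH : (Q :&: H) / K \subset H / K by rewrite quotientS ?subsetIr.
  rewrite -(gcdn_idPl (cardSg sQHKH)); apply/eqP.
  have [k ->] := p_natP qQHK; exact: coprimeXl.
have [] := @path_crossing _ _ (fun A B : {group gT} => A \subset B)
  (fun U : {group gT} => ~~ (U :&: H \subset K)) _ _ _ _ _ Qs.
- by move=> A /=.
- by move=> B A D; apply: subset_trans.
- by move=> A B /= /and3P[].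
- by rewrite negbK.
- by rewrite lastG (setIidPr sHG) proper_subn.
move=> M [L [modML sQM sLG /negPn sMHK nsLHK]]; rewrite lastG in sLG.
(* [Q / C] is a Sylow subgroup of [G / C], so it carries the factor [q ^ 2] into [M / C], whose
   order is 1 or prime. *)
have q2_Q : q ^ 2 %| #|Q / C|.
  rewrite (card_Hall (quotient_pHall (subset_trans sQG nCG) sylQ)).
  have q_q2 : q.-nat (q ^ 2)%N by rewrite pnatX pnat_id.
  by rewrite -(part_pnat_id q_q2) partn_dvd.
have q2_M : q ^ 2 %| #|M / C|.
  by apply: dvdn_trans q2_Q (cardSg _); apply: quotientS.
have q_M : q %| #|M / C| by apply: dvdn_trans q2_M; apply: dvdn_mulr.
have [sMC | prMC] := modular_quotient_prime nsKG nsHG prHK sLG modML sMHK nsLHK.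
  by move: q_M; rewrite (quotientS1 sMC) cards1 dvdn1 gtn_eqF ?prime_gt1.
move: q2_M; rewrite (_ : #|M / C| = q); last by apply/esym/eqP; rewrite -dvdn_prime2.
by rewrite gtnNdvd ?prime_gt0 // ltn_Pmull ?prime_gt1 ?prime_gt0.
Qed.

End SylowModular.

(** * Strong supersolubility as a local condition *)

Definition screen (p : nat) : group_class :=
  classI (abelian_exponent_dvd p.-1) abelian_squarefree_exponent.

Lemma screen_formation p : formation (screen p).
Proof.
apply: formationI; first exact: abelian_exponent_dvd_formation.
exact: abelian_squarefree_exponent_formation.
Qed.

Lemma strongly_supersoluble_LF : eq_class strongly_supersoluble (LF screen).
Proof.
move=> gT G; split=> [[ssG subG] H K chiefHK p p_pr pHK | LFG].
  have [nsKG nsHG _ _] := chief_factorP _ _ _ chiefHK.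
  have prHK := chief_cyclic_prime chiefHK (supersoluble_chief_cyclic ssG chiefHK).
  have sqf := Sylow_submodular_squarefree chiefHK prHK subG.
  split=> //; split; first by case: sqf.
  have [_] := prime_factor_automizer nsKG nsHG prHK.
  rewrite (eqP (_ : p == #|H / K|)) -?dvdn_prime2 //.
  exact: dvdn_trans (exponent_dvdn _).
have centG (H K : {group gT}) : chief_factor G K H -> prime #|H / K| /\
    abelian_squarefree_exponent (G / 'C_G(H / K | 'Q))%G.
- move=> chiefHK; have prHK : prime #|H / K|.
    by apply: (central_chief_prime chiefHK) => p p_pr /(LFG H K chiefHK p p_pr)[].
  by split=> //; have [] := LFG H K chiefHK _ prHK (dvdnn _).
split; last by move=> p P p_pr sylP; apply: central_Sylow_submodular p_pr sylP centG.
by apply: chief_cyclic_supersoluble => H K /centG[prHK _]; apply: prime_cyclic.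
Qed.

Theorem theorem2p6 :
  local_formation strongly_supersoluble /\
  exists f : nat -> group_class,
    local_screen_of strongly_supersoluble f /\
    forall p : nat, prime p ->
      eq_class (f p)
        (classI (abelian_exponent_dvd p.-1) abelian_squarefree_exponent).
Proof.
have screen_local : local_screen screen by move=> p _; apply: screen_formation.
have screen_sU : local_screen_of strongly_supersoluble screen.
  by split=> //; apply: strongly_supersoluble_LF.
split; last by exists screen.
split; last by exists screen.
(* The closure properties of the class are carried over from [LF screen]. *)
have sU := strongly_supersoluble_LF; have [isoLF quoLF resLF] := LF_formation screen_local.
split.
- by move=> gT rT G H isoGH /sU LFG; apply/sU; apply: isoLF LFG.
- by move=> gT G N nsNG /sU LFG; apply/sU; apply: quoLF.
by move=> gT H A B nsA nsB /sU LFA /sU LFB; apply/sU; apply: resLF.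
Qed.
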